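(* For each integer $n\ge 6$, the distributive lattice $B_{3,n}$ is not nice; i.e. there exist partitions $\mu\unlhd\lambda$ of $2n+6$ such that $B_{3,n}$ has a chain partition of type $\lambda$ but no chain partition of type $\mu$.
   Context: For $n\ge 1$, $B_{3,n}$ is the poset on the $2n+6$ elements $\{a,b,c,d,e,f,1',1,2',2,\ldots,n',n\}$ whose order relation is the reflexive–transitive closure of the cover relations: $(i+1)\lessdot i$ and $(i+1)'\lessdot i'$ for $1\le i\le n-1$; $i'\lessdot i$ for $1\le i\le n$; $1'\lessdot e$, $1'\lessdot f$; $1\lessdot b$, $1\lessdot c$; $e\lessdot b$, $e\lessdot d$; $f\lessdot c$, $f\lessdot d$; $b\lessdot a$, $c\lessdot a$, $d\lessdot a$. A chain partition of a finite poset $P$ is a partition of the set $P$ into blocks each of which is a chain; its type is the integer partition formed by the block sizes in weakly decreasing order. For partitions $\mu,\nu$ of the same integer, $\mu\unlhd\nu$ (dominance order) means $\sum_{i\le k}\mu_i\le\sum_{i\le k}\nu_i$ for all $k\ge1$. A poset $P$ is nice if whenever $P$ has a chain partition of type $\lambda$, it also has a chain partition of type $\mu$ for every $\mu\unlhd\lambda$ (equivalently, the incomparability graph of $P$ is nice in the sense of stable partitions). *)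

(* Defs.v *)
From HB Require Import structures.
From mathcomp Require Import all_boot all_order.

Set Implicit Arguments.
Unset Strict Implicit.
Unset Printing Implicit Defensive.

Import Order.TTheory.

Definition is_intpart (N : nat) (s : seq nat) : bool :=
  [&& sorted geq s, all (ltn 0) s & sumn s == N].

(* For integer partitions of the same integer. [take] truncates, so parts
   beyond the length of a partition count as 0. *)
Definition dominated (mu nu : seq nat) : Prop :=
  forall k, 0 < k -> sumn (take k mu) <= sumn (take k nu).

Section ChainPartitions.
Variables (d : Order.disp_t) (P : finPOrderType d).

Definition chain (C : {set P}) : Prop :=
  {in C &, forall x y : P, (x >=< y)%O}.

(* [partition] includes the requirement that all blocks are nonempty. *)
Definition chain_partition (Q : {set {set P}}) : Prop :=
  partition Q [set: P] /\ {in Q, forall C, chain C}.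

Definition partition_type (Q : {set {set P}}) : seq nat :=
  sort geq [seq #|C| | C : {set P} <- enum Q].

Definition has_chain_partition (lam : seq nat) : Prop :=
  exists2 Q : {set {set P}}, chain_partition Q & partition_type Q = lam.

Definition nice : Prop :=
  forall lam mu : seq nat,
    is_intpart #|P| lam -> is_intpart #|P| mu -> dominated mu lam ->
    has_chain_partition lam -> has_chain_partition mu.

End ChainPartitions.

Arguments has_chain_partition {d} P lam.
Arguments nice {d} P.

(* [B3num i] is the element i+1 of the paper and [B3prm i] is (i+1)', since
   'I_n is numbered from 0. *)
Inductive B3 (n : nat) : Type :=
  | B3a | B3b | B3c | B3d | B3e | B3f
  | B3prm of 'I_n
  | B3num of 'I_n.

Arguments B3a {n}.
Arguments B3b {n}.
Arguments B3c {n}.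
Arguments B3d {n}.
Arguments B3e {n}.
Arguments B3f {n}.

Fact B3_display : Order.disp_t. Proof. exact: Order.Disp tt tt. Qed.

Section B3Poset.
Variable n : nat.

Let code := ('I_6 + ('I_n + 'I_n))%type.

Definition B3_encode (x : B3 n) : code :=
  match x with
  | B3a => inl (@Ordinal 6 0 isT)
  | B3b => inl (@Ordinal 6 1 isT)
  | B3c => inl (@Ordinal 6 2 isT)
  | B3d => inl (@Ordinal 6 3 isT)
  | B3e => inl (@Ordinal 6 4 isT)
  | B3f => inl (@Ordinal 6 5 isT)
  | B3prm i => inr (inl i)
  | B3num i => inr (inr i)
  end.

Definition B3_decode (u : code) : B3 n :=
  match u with
  | inl i => nth B3a [:: B3a; B3b; B3c; B3d; B3e; B3f] i
  | inr (inl i) => B3prm i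
  | inr (inr i) => B3num i
  end.

Lemma B3_encodeK : cancel B3_encode B3_decode.
Proof. by case. Qed.

Lemma B3_decodeK : cancel B3_decode B3_encode.
Proof.
case=> [[i lti]|[i|i]] //=.
by do 6?[case: i lti => [|i] lti; first by congr inl; apply: val_inj].
Qed.

HB.instance Definition _ := Finite.copy (B3 n) (can_type B3_encodeK).

Lemma card_B3 : #|{: B3 n}| = 2 * n + 6.
Proof.
have bij : bijective B3_encode.
  by exists B3_decode; [exact: B3_encodeK | exact: B3_decodeK].
by rewrite (bij_eq_card bij) !card_sum !card_ord addnn mul2n addnC.
Qed.

(* [B3cover x y] reads "x is covered by y". *)
Definition B3cover (x y : B3 n) : bool :=
  match x, y with
  | B3num i, B3num j => i == j.+1 :> nat
  | B3prm i, B3prm j => i == j.+1 :> nat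
  | B3prm i, B3num j => i == j
  | B3prm i, B3e | B3prm i, B3f => i == 0 :> nat
  | B3num i, B3b | B3num i, B3c => i == 0 :> nat
  | B3e, B3b | B3e, B3d => true
  | B3f, B3c | B3f, B3d => true
  | B3b, B3a | B3c, B3a | B3d, B3a => true
  | _, _ => false
  end.

(* [connect] is the reflexive-transitive closure. *)
Definition B3le : rel (B3 n) := connect B3cover.

Let depth (x : B3 n) : nat :=
  match x with
  | B3a => 0
  | B3b | B3c | B3d => 1
  | B3e | B3f => 2
  | B3num i => i.+2
  | B3prm i => i.+3
  end.

Let cover_depth x y : B3cover x y -> depth y < depth x.
Proof. by case: x y => [||||||i|i] [||||||j|j] //= => /eqP ->. Qed.

Let le_depth x y : B3le x y -> x = y \/ depth y < depth x.
Proof.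
case/connectP=> p; elim: p x => [|z p IHp] x /=; first by move=> _ ->; left.
case/andP=> /cover_depth ltzx pathp lasty; right.
by case: (IHp z pathp lasty) => [<- //|ltyz]; apply: ltn_trans ltyz ltzx.
Qed.

Lemma B3le_refl : reflexive B3le.
Proof. exact: connect0. Qed.

Lemma B3le_anti : antisymmetric B3le.
Proof.
move=> x y /andP[/le_depth[//|ltyx] /le_depth[//|ltxy]].
by have := ltn_trans ltyx ltxy; rewrite ltnn.
Qed.

Lemma B3le_trans : transitive B3le.
Proof. exact: connect_trans. Qed.

HB.instance Definition _ :=
  Order.Le_isPOrder.Build B3_display (B3 n)
    B3le_refl B3le_anti B3le_trans.

End B3Poset.

(* Main.v *)
(** Collapsing the ladder sends [B3 n] monotonically onto the Boolean lattice
    2^3, with every [B3num i] going to one atom, [e] and [f] to the other two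
    atoms, and [b], [c], [d] to the coatoms. In a partition into three chains
    each block therefore contains exactly one of [b], [c], [d], and the block
    avoiding [e] and [f] contains every [B3num i]; that block has at least n+1
    elements. Hence the type (n, n, 6) does not occur, although it is dominated
    by the type (n+2, n+2, 2). *)
Require Import Defs.
From mathcomp Require Import all_boot all_order.

Set Implicit Arguments.
Unset Strict Implicit.
Unset Printing Implicit Defensive.

(** A fourth element would give a duplicate-free list of length 4 inside [A]. Applied to a set of
    three blocks, this is the pigeonhole step. *)
Lemma card3_cases (T : finType) (A : {set T}) (x y z t : T) :
  #|A| = 3 -> x \in A -> y \in A -> z \in A -> uniq [:: x; y; z] ->
  t \in A -> t \in [:: x; y; z].
Proof.
move=> cardA xA yA zA uniq_xyz tA; apply: contraT => tNxyz.
have: size [:: t; x; y; z] <= #|A|.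
  rewrite cardE; apply: uniq_leq_size; first by rewrite cons_uniq tNxyz.
  by move=> u; rewrite mem_enum !inE => /or4P[] /eqP->.
by rewrite cardA.
Qed.

(** * Types and blocks of chain partitions *)

Section ChainPartitionTypes.
Variables (d : Order.disp_t) (P : finPOrderType d).
Implicit Types (Q : {set {set P}}) (x y : P).

Lemma perm_partition_type Q :
  perm_eq (partition_type Q) [seq #|C| | C : {set P} <- enum Q].
Proof. by rewrite /partition_type perm_sort. Qed.

Lemma size_partition_type Q : size (partition_type Q) = #|Q|.
Proof. by rewrite size_sort size_map cardE. Qed.

Lemma card_mem_partition_type Q C : C \in Q -> #|C| \in partition_type Q.
Proof.
by move=> CQ; rewrite (perm_mem (perm_partition_type Q)) map_f ?mem_enum.
Qed.

(** A decreasing list is determined by its multiset, so the type can be read off an explicit list of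
    blocks. *)
Lemma partition_type_seq (s : seq {set P}) (lam : seq nat) :
  uniq s -> sorted geq lam -> [seq #|C| | C : {set P} <- s] = lam ->
  partition_type [set:: s] = lam.
Proof.
move=> uniq_s sorted_lam lamE.
have geq_trans: transitive geq by move=> p q r /= pq rp; apply: leq_trans pq.
have geq_anti: antisymmetric geq.
  by move=> p q /= /andP[pq qp]; apply/anti_leq/andP.
apply: (sorted_eq geq_trans geq_anti).
- by apply: sort_sorted => p q; apply: leq_total.
- exact: sorted_lam.
rewrite -lamE; apply: (perm_trans (perm_partition_type _)).
apply/perm_map/uniq_perm => //; first exact: enum_uniq.
by move=> C; rewrite mem_enum inE.
Qed.

(** Used contrapositively: incomparable elements lie in different blocks. *)
Lemma pblock_comparable Q x y :
  chain_partition Q -> pblock Q x = pblock Q y -> (x >=< y)%O.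
Proof.
case=> /and3P[/eqP covQ _ _] chainQ eq_xy.
have inQ z : z \in cover Q by rewrite covQ inE.
apply: (chainQ (pblock Q x)); first exact: pblock_mem.
- by rewrite mem_pblock.
- by rewrite eq_xy mem_pblock.
Qed.

End ChainPartitionTypes.

(** * The map to the Boolean cube and the order on the ladder *)

Section B3Order.
Variable n : nat.
Implicit Types x y : B3 n.

(** For positive [n], the coordinates record whether [x] lies above some [B3num i], above [B3e],
    above [B3f]. *)
Definition to_cube x : bool * bool * bool :=
  match x with
  | B3a => (true, true, true)
  | B3b => (true, true, false)
  | B3c => (true, false, true)
  | B3d => (false, true, true)
  | B3e => (false, true, false)
  | B3f => (false, false, true)
  | B3num _ => (true, false, false)
  | B3prm _ => (false, false, false)
  end.

Definition cube_le (u v : bool * bool * bool) : bool :=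
  [&& u.1.1 ==> v.1.1, u.1.2 ==> v.1.2 & u.2 ==> v.2].

Lemma to_cube_homo x y : (x <= y)%O -> cube_le (to_cube x) (to_cube y).
Proof.
case/connectP=> p; elim: p x => [|z p IHp] x /=.
  by move=> _ ->; rewrite /cube_le !implybb.
case/andP=> xz zp /(IHp z zp).
by case: x z xz {IHp zp} => [||||||i|i] [||||||j|j] //= _; case: y.
Qed.

(** Gives a computable certificate of incomparability: cube images that are incomparable. No
    reasoning about paths in [connect] is then required. *)
Lemma comparable_to_cube x y :
  (x >=< y)%O ->
  cube_le (to_cube x) (to_cube y) || cube_le (to_cube y) (to_cube x).
Proof. by case/orP=> /to_cube_homo ->; rewrite ?orbT. Qed.

Lemma B3num_inj : injective (@B3num n). Proof. by move=> i j []. Qed.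

Lemma B3prm_inj : injective (@B3prm n). Proof. by move=> i j []. Qed.

Lemma B3cover_le x y : B3cover x y -> (x <= y)%O.
Proof. exact: connect1. Qed.

(** Larger indices lie lower, so the induction on [i] descends from the top of one side of the
    ladder. *)
Lemma ladder_le (g : 'I_n -> B3 n) :
  (forall i j : 'I_n, i = j.+1 :> nat -> (g i <= g j)%O) ->
  forall i j : 'I_n, j <= i -> (g i <= g j)%O.
Proof.
move=> gS i j; case: i => m; elim: m => [|m IHm] ltmn /= lejm.
  by have -> : j = Ordinal ltmn by apply/val_inj/eqP; rewrite /= -leqn0.
move: lejm; rewrite leq_eqVlt => /orP[/eqP eqjm|ltjm].
  by have -> : j = Ordinal ltmn by apply: val_inj.
apply: Order.POrderTheory.le_trans (IHm (ltnW ltmn) ltjm).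
exact: gS.
Qed.

Lemma B3num_le (i j : 'I_n) : j <= i -> (B3num i <= B3num j :> B3 n)%O.
Proof. by apply: ladder_le => {}i {}j ij; apply: B3cover_le; apply/eqP. Qed.

Lemma B3prm_le (i j : 'I_n) : j <= i -> (B3prm i <= B3prm j :> B3 n)%O.
Proof. by apply: ladder_le => {}i {}j ij; apply: B3cover_le; apply/eqP. Qed.

Lemma B3num_le_b (i : 'I_n) : (B3num i <= B3b :> B3 n)%O.
Proof.
have n_gt0 : 0 < n by apply: leq_trans (ltn_ord i).
apply: Order.POrderTheory.le_trans (B3num_le (leq0n i : Ordinal n_gt0 <= i)) _.
exact: B3cover_le.
Qed.

Lemma B3prm_le_e (i : 'I_n) : (B3prm i <= B3e :> B3 n)%O.
Proof.
have n_gt0 : 0 < n by apply: leq_trans (ltn_ord i).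
apply: Order.POrderTheory.le_trans (B3prm_le (leq0n i : Ordinal n_gt0 <= i)) _.
exact: B3cover_le.
Qed.

(** * A partition into two long chains and a pair *)

Lemma ladder_chain (g : 'I_n -> B3 n) x y :
  (forall i j : 'I_n, j <= i -> (g i <= g j)%O) ->
  (forall i, (g i <= y)%O) -> (y <= x)%O ->
  chain (x |: (y |: [set g i | i in 'I_n])).
Proof.
move=> gle gy yx; have gx i : (g i <= x)%O.
  exact: Order.POrderTheory.le_trans (gy i) yx.
move=> u v; rewrite !inE.
case/or3P=> [/eqP->|/eqP->|/imsetP[i _ ->]];
  case/or3P=> [/eqP->|/eqP->|/imsetP[j _ ->]];
  rewrite /Order.comparable ?Order.POrderTheory.lexx ?yx ?gx ?gy ?orbT //.
by case/orP: (leq_total i j) => /gle ->; rewrite ?orbT.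
Qed.

Lemma card_ladder_chain (g : 'I_n -> B3 n) x y :
  injective g -> x != y -> (forall i, g i != x) -> (forall i, g i != y) ->
  #|x |: (y |: [set g i | i in 'I_n])| = n.+2.
Proof.
move=> ginj xy gx gy; have gN z : (forall i, g i != z) -> z \notin g @: 'I_n.
  by move=> gz; apply/imsetP=> -[i _ zE]; have := gz i; rewrite zE eqxx.
by rewrite !cardsU1 !inE negb_or xy !gN // card_imset // card_ord.
Qed.

(** Each side of the ladder is extended upwards by two elements: the unprimed side by [b < a], the
    primed side by [e < d]. The pair [f < c] remains. *)
Lemma B3_has_chain_partition : has_chain_partition (B3 n) [:: n.+2; n.+2; 2].
Proof.
pose A : {set B3 n} := B3a |: (B3b |: [set B3num i | i in 'I_n]).
pose B : {set B3 n} := B3d |: (B3e |: [set B3prm i | i in 'I_n]).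
pose C : {set B3 n} := [set B3c; B3f].
have numP i : (B3num i \in [set B3num i | i in 'I_n]) by apply: imset_f.
have prmP i : (B3prm i \in [set B3prm i | i in 'I_n]) by apply: imset_f.
have numN x : to_cube x != (true, false, false) ->
    (x \in [set B3num i | i in 'I_n]) = false.
  by move=> xN; apply/imsetP=> -[i _ xE]; rewrite xE in xN.
have prmN x : to_cube x != (false, false, false) ->
    (x \in [set B3prm i | i in 'I_n]) = false.
  by move=> xN; apply/imsetP=> -[i _ xE]; rewrite xE in xN.
have cardA : #|A| = n.+2 by apply: card_ladder_chain => //; apply: B3num_inj.
have cardB : #|B| = n.+2 by apply: card_ladder_chain => //; apply: B3prm_inj.
have cardC : #|C| = 2 by rewrite cards2.
(* The two sides of the ladder are fibres of [to_cube], so membership in each block becomes a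
   boolean test settled by cases on [x]. *)
have memA x : (x \in A) = (x \in [:: B3a; B3b]) || (to_cube x == (true, false, false)).
  by rewrite !inE; case: x => [||||||i|i]; rewrite ?numP ?numN.
have memB x : (x \in B) = (x \in [:: B3d; B3e]) || (to_cube x == (false, false, false)).
  by rewrite !inE; case: x => [||||||i|i]; rewrite ?prmP ?prmN.
have memC x : (x \in C) = (x \in [:: B3c; B3f]) by rewrite !inE.
have AB : A != B by apply/eqP=> /setP/(_ B3a); rewrite memA memB.
have AC : A != C by apply/eqP=> /setP/(_ B3a); rewrite memA memC.
have BC : B != C by apply/eqP=> /setP/(_ B3d); rewrite memB memC.
exists [set:: [:: A; B; C]]; last first.
  apply: partition_type_seq => /=; last by rewrite cardA cardB cardC.
    by rewrite !inE negb_or AB AC BC.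
  by rewrite /= leqnn.
split; last first.
  move=> D; rewrite !inE => /or3P[] /eqP->.
  - by apply: ladder_chain; [exact: B3num_le | exact: B3num_le_b | exact: B3cover_le].
  - by apply: ladder_chain; [exact: B3prm_le | exact: B3prm_le_e | exact: B3cover_le].
  - have fc : (B3f <= B3c :> B3 n)%O by exact: B3cover_le.
    move=> x y; rewrite !inE.
    by case/orP=> /eqP->; case/orP=> /eqP->;
      rewrite /Order.comparable ?Order.POrderTheory.lexx ?fc ?orbT.
apply/and3P; split.
- apply/eqP/setP=> x; rewrite inE; apply/bigcupP.
  case: x => [||||||i|i].
  + by exists A; rewrite ?memA // !inE eqxx.
  + by exists A; rewrite ?memA // !inE eqxx.
  + by exists C; rewrite ?memC // !inE eqxx ?orbT.
  + by exists B; rewrite ?memB // !inE eqxx ?orbT.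
  + by exists B; rewrite ?memB // !inE eqxx ?orbT.
  + by exists C; rewrite ?memC // !inE eqxx ?orbT.
  + by exists B; rewrite ?memB // !inE eqxx ?orbT.
  + by exists A; rewrite ?memA // !inE eqxx.
- apply/trivIsetP=> D E; rewrite !inE.
  by case/or3P=> /eqP->; case/or3P=> /eqP->; rewrite ?eqxx // => _;
    apply/pred0P=> x /=; rewrite ?memA ?memB ?memC; case: x.
- rewrite !inE !negb_or.
  by rewrite ![set0 == _]eq_sym -!cards_eq0 cardA cardB cardC.
Qed.

(** In a partition into three chains, every antichain of size 3 meets each block exactly once. This
    is used for [e, f, z] and for [b, c, d]. *)
Lemma B3_three_chains (Q : {set {set B3 n}}) :
  0 < n -> chain_partition Q -> #|Q| = 3 -> exists2 C, C \in Q & n < #|C|.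
Proof.
move=> n_gt0 Qchain cardQ; case: (Qchain) => /and3P[/eqP covQ _ _] _.
have inQ x : x \in cover Q by rewrite covQ inE.
pose pb := pblock Q; have pbQ x : pb x \in Q by apply: pblock_mem.
have pbN x y : ~~ (cube_le (to_cube x) (to_cube y)
    || cube_le (to_cube y) (to_cube x)) -> (pb x == pb y) = false.
  move=> xyN; apply: contraNF xyN => /eqP pbxy.
  exact/comparable_to_cube/(pblock_comparable Qchain).
pose z := B3num (Ordinal n_gt0) : B3 n.
(* [B3num i] is incomparable to [e] and [f], which leaves only the block of [z]. *)
have pbnum i : pb (B3num i) = pb z.
  have uniq_efz : uniq [:: pb B3e; pb B3f; pb z] by rewrite /= !inE !pbN.
  have := card3_cases cardQ (pbQ _) (pbQ _) (pbQ _) uniq_efz (pbQ (B3num i)).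
  by rewrite !inE (pbN _ B3e) // (pbN _ B3f) // => /eqP.
(* The block of [z] contains one of [b, c, d], and not [d], which is incomparable to [z]. So [b] or
   [c] joins the [n] unprimed elements. *)
have [y yN pby] : exists2 y, (forall i, B3num i != y) & pb y = pb z.
  have uniq_bcd : uniq [:: pb B3b; pb B3c; pb B3d] by rewrite /= !inE !pbN.
  have := card3_cases cardQ (pbQ _) (pbQ _) (pbQ _) uniq_bcd (pbQ z).
  rewrite !inE (pbN _ B3d) // orbF => /orP[] /eqP zE.
    by exists B3b.
  by exists B3c.
exists (pb z) => //.
have <- : #|y |: [set B3num i | i in 'I_n]| = n.+1.
  rewrite cardsU1 card_imset ?card_ord; last exact: B3num_inj.
  by case: imsetP => // -[i _ yE]; have := yN i; rewrite yE eqxx.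
apply/subset_leq_card/subsetP=> x; rewrite !inE.
case/orP=> [/eqP->|/imsetP[i _ ->]].
  by rewrite -pby mem_pblock.
by rewrite -(pbnum i) mem_pblock.
Qed.

End B3Order.

Theorem theorem3p2 (n : nat) (hn : 6 <= n) :
  ~ nice (B3 n) /\
  exists lam mu : seq nat,
    [/\ is_intpart (2 * n + 6) lam, is_intpart (2 * n + 6) mu,
        dominated mu lam,
        has_chain_partition (B3 n) lam
      & ~ has_chain_partition (B3 n) mu].
Proof.
have n_gt0 : 0 < n by apply: leq_trans hn.
have lamP : is_intpart (2 * n + 6) [:: n.+2; n.+2; 2].
  by rewrite /is_intpart /= leqnn /= !(addSn, addnS, addn0) mul2n addnn.
have muP : is_intpart (2 * n + 6) [:: n; n; 6].
  by rewrite /is_intpart /= leqnn hn n_gt0 /= addn0 addnA mul2n addnn eqxx.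
(* The partial sums are [n <= n+2], [2n <= 2n+4], and [2n+6] on both sides from the third on. *)
have dom : dominated [:: n; n; 6] [:: n.+2; n.+2; 2].
  have le_n : n <= n.+2 by rewrite !leqW.
  case=> [|[|[|k]]] // _ /=; first by rewrite !addn0.
    by rewrite !addn0 leq_add.
  by rewrite !(addSn, addnS, addn0).
have muN : ~ has_chain_partition (B3 n) [:: n; n; 6].
  case=> Q Qchain typeQ.
  have cardQ : #|Q| = 3 by rewrite -size_partition_type typeQ.
  have [C CQ] := B3_three_chains n_gt0 Qchain cardQ.
  (* The block [C] has more than [n] elements, but no part of [(n, n, 6)] exceeds [n], since
     [6 <= n]. *)
  have := card_mem_partition_type CQ; rewrite typeQ !inE ltnNge.
  by case/or3P=> /eqP->; rewrite ?leqnn ?hn.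
split; last first.
  by exists [:: n.+2; n.+2; 2], [:: n; n; 6]; split=> //; apply: B3_has_chain_partition.
move=> niceB; apply: muN; apply: (niceB [:: n.+2; n.+2; 2]) => //.
- by rewrite card_B3.
- by rewrite card_B3.
- exact: B3_has_chain_partition.
Qed.
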